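(* Let $\mathcal{D}$ be a symmetric $(15,8,4)$-design and let $\mathrm{Aut}(\mathcal{D})$ be its full automorphism group. The following assertions hold: (i) If $\mathcal{D}$ is of type (C2), then $\mathrm{Aut}(\mathcal{D})$ is the (internal) semidirect product of a normal subgroup isomorphic to $C_2^2\rtimes S_4$ and a subgroup isomorphic to $S_3$. (ii) If $\mathcal{D}$ is of type (C3), then $\mathrm{Aut}(\mathcal{D})$ is the (internal) semidirect product of a normal subgroup isomorphic to $C_2^3$ and a subgroup isomorphic to $A_4$. (iii) If $\mathcal{D}$ is of type (C4) or (NC), then $\mathrm{Aut}(\mathcal{D})$ is the (internal) semidirect product of a normal subgroup isomorphic to $C_2^3$ and a subgroup isomorphic to $C_7\rtimes C_3$.
   Context: A symmetric $(n,2m,m)$-design is an incidence structure of $n$ points and $n$ blocks such that each block consists of $2m$ points and any two distinct blocks meet in precisely $m$ points. An automorphism is a bijection of the point set preserving the set of blocks. We take $n=15$, $m=4$ and the point set $[15]=\{1,\dots,15\}$, so the set of blocks $\mathcal{B}$ consists of fifteen $8$-element subsets of $[15]$, any two distinct ones meeting in $4$ elements. $\mathcal{P}_4(15)$ is the point-line geometry whose points are all $8$-element subsets of $[15]$ and whose lines are the triples $\{X,Y,X\triangle Y\}$ of $8$-element subsets ($\triangle$ is symmetric difference). Two distinct points $X,Y$ are collinear iff $|X\cap Y|=4$. The sets of blocks of symmetric $(15,8,4)$-designs on $[15]$ are precisely the $15$-cliques of the collinearity graph of $\mathcal{P}_4(15)$. A singular subspace is a set of pairwise collinear points containing the line through any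 two of its distinct points; maximal singular subspaces are isomorphic to $\mathrm{PG}(3,2)$ (15 points). A Fano plane in $\mathcal{P}_4(15)$ is a singular subspace isomorphic to $\mathrm{PG}(2,2)$ (7 points). Types of a design, according to its $15$-clique $\mathcal{B}$ of blocks: (C1) $\mathcal{B}$ is a maximal singular subspace; (C2) $\mathcal{B}$ is the union of three Fano planes through a common line, and a line of $\mathcal{P}_4(15)$ is contained in $\mathcal{B}$ iff it is a line of one of these Fano planes; (C3) $\mathcal{B}$ is the union of a Fano plane and four lines through a certain point of it, and a line of $\mathcal{P}_4(15)$ is contained in $\mathcal{B}$ iff it is a line of the Fano plane or one of these four lines; (C4) $\mathcal{B}$ is the union of seven lines through a point, and a line of $\mathcal{P}_4(15)$ is contained in $\mathcal{B}$ iff it is one of these seven lines; (NC) $\mathcal{B}$ is the union of a maximal singular subspace with a Fano plane deleted and a Fano plane disjoint from this subspace, and a line of $\mathcal{P}_4(15)$ is contained in $\mathcal{B}$ iff it is a line of the latter Fano plane. Every symmetric $(15,8,4)$-design is of exactly one of these types, and two of them are isomorphic iff they are of the same type. $C_k$ is the cyclic group of order $k$, $S_k$, $A_k$ the symmetric and alternating groups. $A\rtimes B$ denotes a semidirect product with normal factor $A$; $C_7\rtimes C_3$ is the non-abelian group of order $21$; for $C_2^2\rtimes S_4$ the action is not specified in the statement. *)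

(* Defs.v *)
From HB Require Import structures.
From mathcomp Require Import all_boot all_order all_algebra.
From mathcomp Require Import all_fingroup all_solvable.

Set Implicit Arguments.
Unset Strict Implicit.
Unset Printing Implicit Defensive.

Import GroupScope.

Definition symmetric_design (n m : nat) (B : {set {set 'I_n}}) : Prop :=
  [/\ #|B| = n,
      (forall X, X \in B -> #|X| = 2 * m)%N
    & forall X Y, X \in B -> Y \in B -> X != Y -> #|X :&: Y| = m].

(* 'P^* is the action of permutations on sets of points, and 'N(B | _) is the
   global stabiliser of B; see design_autP. *)
Definition design_aut (n : nat) (B : {set {set 'I_n}}) :
  {group {perm 'I_n}} := 'N(B | 'P^* )%G.

Lemma design_autP (n : nat) (B : {set {set 'I_n}}) (s : {perm 'I_n}) :
  reflect ([set s @: X | X : {set 'I_n} in B] = B) (s \in design_aut B).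
Proof.
have E : [set s @: X | X : {set 'I_n} in B] = 'P^*^*%act B s by [].
rewrite E /design_aut /=; apply: (iffP idP) => [/astabs_setact // | sB].
by rewrite -astab1_set; apply/astab1P.
Qed.

Definition symdiff (T : finType) (X Y : {set T}) : {set T} :=
  (X :\: Y) :|: (Y :\: X).

(* The geometry P_4(15): points are the 8-subsets of 'I_15.  The two points
   generating a line are automatically distinct, since #|symdiff X Y| = 8. *)
Definition is_point (X : {set 'I_15}) : bool := #|X| == 8.

Definition is_line (L : {set {set 'I_15}}) : bool :=
  [exists X : {set 'I_15}, exists Y : {set 'I_15},
    [&& is_point X, is_point Y, is_point (symdiff X Y)
      & L == [set X; Y; symdiff X Y]]].

Definition collinear (X Y : {set 'I_15}) : bool :=
  [exists L : {set {set 'I_15}}, [&& is_line L, X \in L & Y \in L]].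

Definition singular (S : {set {set 'I_15}}) : bool :=
  [forall X in S, is_point X] &&
  [forall X in S, forall Y in S, (X != Y) ==>
     collinear X Y &&
     [forall L : {set {set 'I_15}},
       [&& is_line L, X \in L & Y \in L] ==> (L \subset S)]].

Definition maximal_singular (S : {set {set 'I_15}}) : bool :=
  maxset singular S.

(* Over F_2 every one-dimensional subspace contains exactly one nonzero vector,
   so the points of PG(d, 2) are encoded as the nonzero vectors of F_2^(d+1),
   and its lines as the triples {u, v, u + v}. *)
Definition PG_line (d : nat) (L : {set 'rV['F_2]_d.+1}) : bool :=
  [exists u : 'rV['F_2]_d.+1, exists v : 'rV['F_2]_d.+1,
    [&& u != 0, v != 0, u != v & L == [set u; v; u + v]]]%R.

Definition isomorphic_to_PG (d : nat) (S : {set {set 'I_15}}) : Prop :=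
  exists f : 'rV['F_2]_d.+1 -> {set 'I_15},
    [/\ {in [set~ 0%R] &, injective f},
        f @: [set~ 0%R] = S
      & forall L : {set 'rV['F_2]_d.+1},
          L \subset [set~ 0%R] -> PG_line L = is_line (f @: L)].

Definition fano_plane (S : {set {set 'I_15}}) : Prop :=
  singular S /\ isomorphic_to_PG 2 S.

Definition type_C2 (B : {set {set 'I_15}}) : Prop :=
  exists (F1 F2 F3 L : {set {set 'I_15}}),
    [/\ [/\ fano_plane F1, fano_plane F2 & fano_plane F3],
        [/\ F1 != F2, F1 != F3 & F2 != F3],
        is_line L /\ [/\ L \subset F1, L \subset F2 & L \subset F3],
        B = F1 :|: F2 :|: F3
      & forall M, is_line M ->
          (M \subset B) = [|| M \subset F1, M \subset F2 | M \subset F3]].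

Definition type_C3 (B : {set {set 'I_15}}) : Prop :=
  exists (F : {set {set 'I_15}}) (p : {set 'I_15})
         (Ls : {set {set {set 'I_15}}}),
    [/\ fano_plane F /\ p \in F,
        #|Ls| = 4,
        forall L, L \in Ls -> is_line L /\ p \in L,
        B = F :|: cover Ls
      & forall M, is_line M ->
          (M \subset B) = (M \subset F) || (M \in Ls)].

Definition type_C4 (B : {set {set 'I_15}}) : Prop :=
  exists (p : {set 'I_15}) (Ls : {set {set {set 'I_15}}}),
    [/\ #|Ls| = 7,
        forall L, L \in Ls -> is_line L /\ p \in L,
        B = cover Ls
      & forall M, is_line M -> (M \subset B) = (M \in Ls)].

Definition type_NC (B : {set {set 'I_15}}) : Prop :=
  exists (S F G : {set {set 'I_15}}),
    [/\ maximal_singular S,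
        fano_plane F /\ F \subset S,
        fano_plane G /\ [disjoint G & S],
        B = (S :\: F) :|: G
      & forall M, is_line M -> (M \subset B) = (M \subset G)].

(* The internal semidirect product, with some (possibly trivial) action. *)
Definition is_semidirect (gT aT bT : finGroupType)
    (G : {set gT}) (A : {set aT}) (B : {set bT}) : Prop :=
  exists N H : {group gT}, [/\ N ><| H = G, N \isog A & H \isog B].

(* Zp n is the additive group of integers modulo n, i.e. the cyclic group C_n. *)
Definition C2_pow2 : {set 'Z_2 * 'Z_2} := setX (Zp 2) (Zp 2).
Definition C2_pow3 : {set 'Z_2 * 'Z_2 * 'Z_2} := setX C2_pow2 (Zp 2).

Definition is_C7_rtimes_C3 (gT : finGroupType) (G : {set gT}) : Prop :=
  is_semidirect G (Zp 7) (Zp 3) /\ ~~ abelian G.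

(* Main.v *)
Require Import Defs.
From HB Require Import structures.
From mathcomp Require Import all_boot all_order all_algebra.
From mathcomp Require Import all_fingroup all_solvable zify.

Import GroupScope.

(** Each type provides three blocks meeting pairwise in 4 points and all together
    in 2 points, for instance a basis of a Fano plane.  The eight regions they
    cut out have known sizes, so the points can be labelled so that the three
    blocks become standard.  A backtracking search then finds all completions of
    these blocks (and of the blocks which the type generates from them) to a
    design; each completion that satisfies a consequence of the type is
    isomorphic to one explicit design.  It remains to treat four explicit
    designs.  For each of them, a subgroup of the expected structure is given by
    generators, and it is the full automorphism group because automorphisms are
    determined by the images of the first few points, whose possible images are
    counted by another backtracking search. *)

Set Implicit Arguments.
Unset Strict Implicit.
Unset Printing Implicit Defensive.

(** * Recognising elementary abelian 2-groups and cyclic groups of prime order *)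

Lemma abelem2_sqr (gT : finGroupType) (G : {group gT}) :
  {in G, forall x, x * x = 1} -> 2.-abelem G.
Proof.
move=> G2; apply/abelemP => //; split; last first.
  by move=> x xG; rewrite expgS expg1 G2.
apply/centsP=> x xG y yG; have xV z : z \in G -> z^-1 = z.
  by move=> zG; apply: (mulgI z); rewrite mulgV G2.
by rewrite /commute -[LHS]xV ?groupM // invMg !xV.
Qed.

Lemma Z2_sqr (x : 'Z_2) : x * x = 1.
Proof. by apply/val_inj; case: x => [[|[|]]]. Qed.

Lemma C2_pow2_sqr x : x \in C2_pow2 -> x * x = 1.
Proof. by case: x => u v _; congr (_, _); apply: Z2_sqr. Qed.

Lemma C2_pow3_sqr x : x \in C2_pow3 -> x * x = 1.
Proof.
by case: x => [[u v] w] _; congr (_, _); [congr (_, _)|]; apply: Z2_sqr.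
Qed.

Lemma isog_C2_pow2 (gT : finGroupType) (G : {group gT}) :
  2.-abelem G -> #|G| = 4 -> G \isog C2_pow2.
Proof.
move=> aG cG; rewrite (isog_abelem_card [group of C2_pow2] aG) cG.
by rewrite abelem2_sqr ?cardsX ?card_Zp //; apply: C2_pow2_sqr.
Qed.

Lemma isog_C2_pow3 (gT : finGroupType) (G : {group gT}) :
  2.-abelem G -> #|G| = 8 -> G \isog C2_pow3.
Proof.
move=> aG cG; rewrite (isog_abelem_card [group of C2_pow3] aG) cG.
by rewrite abelem2_sqr ?cardsX ?card_Zp //; apply: C2_pow3_sqr.
Qed.

Lemma isog_Zp_prime (gT : finGroupType) (G : {group gT}) p :
  prime p -> #|G| = p -> G \isog Zp p.
Proof.
move=> pp cG; rewrite isog_cyclic_card ?prime_cyclic ?cG //=.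
  by rewrite card_Zp ?prime_gt0.
by rewrite card_Zp ?prime_gt0.
Qed.

Lemma isogJ (gT aT : finGroupType) (G : {group gT}) (A : {group aT}) x :
  G \isog A -> (G :^ x)%G \isog A.
Proof. by apply: isog_trans; rewrite isog_sym conj_isog. Qed.

Lemma is_semidirectJ (gT aT bT : finGroupType) (G : {set gT}) (A : {group aT})
    (C : {group bT}) x :
  is_semidirect G A C -> is_semidirect (G :^ x) A C.
Proof.
case=> N [H [defG iN iH]]; exists (N :^ x)%G, (H :^ x)%G.
by rewrite -defG sdprodJ; split=> //; apply: isogJ.
Qed.

(** * Permutation groups given by lists of tables *)

(* Permutations are represented by tables of values.  Products are taken in the
   order of permM: tmul t u applies t first. *)
Definition tab n (s : 'S_n) : seq nat := [seq val (s i) | i <- enum 'I_n].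
Definition tmul (t u : seq nat) := [seq nth 0 u x | x <- t].
Definition tinv n (t : seq nat) := [seq index i t | i <- iota 0 n].

Section Tables.
Variable n : nat.
Implicit Types (s w : 'S_n) (t u : seq nat).

Lemma size_tab s : size (tab s) = n.
Proof. by rewrite size_map size_enum_ord. Qed.

Lemma nth_tab s (i : 'I_n) : nth 0 (tab s) i = s i.
Proof. by rewrite (nth_map i) ?size_enum_ord ?nth_ord_enum. Qed.

Lemma tab_inj : injective (@tab n).
Proof.
by move=> s w E; apply/permP=> i; apply: val_inj; rewrite /= -!nth_tab E.
Qed.

Lemma eq_tabP s t :
  size t = n -> (forall i : 'I_n, nth 0 t i = s i) -> tab s = t.
Proof.
move=> st E; apply: (@eq_from_nth _ 0); first by rewrite size_tab.
by move=> i; rewrite size_tab => li; rewrite (nth_tab s (Ordinal li)) -E.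
Qed.

Lemma tab1 : tab (1 : 'S_n) = iota 0 n.
Proof. by apply: eq_tabP => [|i]; rewrite ?size_iota // nth_iota // perm1. Qed.

Lemma tabM s w : tab (s * w) = tmul (tab s) (tab w).
Proof.
apply: eq_tabP => [|i]; first by rewrite size_map size_tab.
by rewrite (nth_map 0) ?size_tab // nth_tab nth_tab permM.
Qed.

Lemma tab_uniq s : uniq (tab s).
Proof. by rewrite map_inj_uniq ?enum_uniq // => i j /val_inj /perm_inj. Qed.

Lemma tabV s : tab s^-1 = tinv n (tab s).
Proof.
apply: eq_tabP => [|i]; first by rewrite size_map size_iota.
rewrite (nth_map 0) ?size_iota // nth_iota // add0n.
rewrite -{1}[i](permKV s) -nth_tab index_uniq ?tab_uniq //.
by rewrite size_tab.
Qed.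

Definition is_tab t := perm_eq t (iota 0 n).

Lemma is_tabP t : is_tab t -> exists s, tab s = t.
Proof.
move=> pt; have st : size t = n by rewrite (perm_size pt) size_iota.
have lt (i : 'I_n) : nth 0 t i < n.
  have: nth 0 t i \in iota 0 n by rewrite -(perm_mem pt) mem_nth ?st.
  by rewrite mem_iota.
have fI : injective (fun i => Ordinal (lt i)).
  move=> i j [/eqP]; rewrite nth_uniq ?st //; first by move/eqP/val_inj.
  by rewrite (perm_uniq pt) iota_uniq.
by exists (perm fI); apply: eq_tabP => // i; rewrite permE.
Qed.

Definition tabs_set (T : seq (seq nat)) : {set 'S_n} := [set s | tab s \in T].

Definition is_tab_group (T : seq (seq nat)) :=
  [&& all is_tab T, uniq T, iota 0 n \in T
    & all (fun t => all (fun u => tmul t u \in T) T) T].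

Lemma tab_group_set T : is_tab_group T -> group_set (tabs_set T).
Proof.
case/and4P=> _ _ T1 TM; apply/group_setP; split; first by rewrite inE tab1.
move=> s w; rewrite !inE tabM => sT wT.
exact: (allP (allP TM _ sT)).
Qed.

Lemma card_tabs_set T :
  all is_tab T -> uniq T -> #|tabs_set T| = size T.
Proof.
move=> vT uT; rewrite cardE -(size_map (@tab n)); apply/perm_size.
apply: uniq_perm; rewrite ?(map_inj_uniq tab_inj) ?enum_uniq // => t.
apply/mapP/idP => [[s] | tT]; first by rewrite mem_enum inE => sT ->.
by have [s E] := is_tabP (allP vT _ tT); exists s; rewrite ?mem_enum ?inE E.
Qed.

Definition tab_group T (gT : is_tab_group T) := Group (tab_group_set gT).

Lemma card_tab_group T (gT : is_tab_group T) : #|tab_group gT| = size T.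
Proof. by case/and4P: (gT) => vT uT _ _; apply: card_tabs_set. Qed.

(** The product of the two subgroups lies in [G] by closure and has order [size TN * size TH], so
    the upper bound on [#|G|] forces equality. Only closure under products is asked of [G], which
    suits the plain set [code_aut]. *)
Lemma tab_group_sdprod (TN TH : seq (seq nat)) (gN : is_tab_group TN)
    (gH : is_tab_group TH) (G : {set 'S_n}) :
  (forall s w, s \in G -> w \in G -> s * w \in G) ->
  tab_group gN \subset G -> tab_group gH \subset G ->
  #|G| <= size TN * size TH ->
  all (fun h => all (fun x => tmul (tmul (tinv n h) x) h \in TN) TN) TH ->
  all (fun h => (h \in TN) ==> (h == iota 0 n)) TH ->
  tab_group gN ><| tab_group gH = G.
Proof.
move=> GM sN sH cG nNH tiNH.
have nn : tab_group gH \subset 'N(tab_group gN).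
  apply/subsetP=> h; rewrite inE => hH; rewrite inE; apply/subsetP=> _ /imsetP[x xN ->].
  rewrite inE in xN; rewrite inE conjgE mulgA !tabM tabV.
  exact: (allP (allP nNH _ hH) _ xN).
have ti : tab_group gN :&: tab_group gH = 1.
  apply/trivgP/subsetP=> h; rewrite !inE => /andP[hN hH]; apply/eqP/tab_inj.
  by rewrite tab1; apply/eqP; have := allP tiNH _ hH; rewrite hN.
rewrite sdprodE //; apply/eqP; rewrite eqEcard; apply/andP; split.
  apply/subsetP=> _ /mulsgP[x y xN yH ->]; apply: GM.
    exact: (subsetP sN). exact: (subsetP sH).
by rewrite TI_cardMg // !card_tab_group.
Qed.

Lemma tab_group_TI_sdprod (TN TH TG : seq (seq nat)) (gN : is_tab_group TN)
    (gH : is_tab_group TH) (gG : is_tab_group TG) :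
  all (mem TG) (TN ++ TH) -> size TG = (size TN * size TH)%N ->
  all (fun h => all (fun x => tmul (tmul (tinv n h) x) h \in TN) TN) TH ->
  all (fun h => (h \in TN) ==> (h == iota 0 n)) TH ->
  tab_group gN ><| tab_group gH = tab_group gG.
Proof.
rewrite all_cat => /andP[/allP sN /allP sH] sz nNH tiNH.
apply: tab_group_sdprod => //; last by rewrite card_tab_group sz.
- by move=> s w; apply: groupM.
- by apply/subsetP=> s; rewrite !inE; apply: sN.
- by apply/subsetP=> s; rewrite !inE; apply: sH.
Qed.

Lemma tab_group_abelem2 T (gT : is_tab_group T) :
  all (fun t => tmul t t == iota 0 n) T -> 2.-abelem (tab_group gT).
Proof.
move=> T2; apply: abelem2_sqr => s; rewrite inE => sT; apply: tab_inj.
by rewrite tabM tab1; apply/eqP/(allP T2).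
Qed.
End Tables.

Lemma uniq_map_inj (T1 T2 : eqType) (g : T1 -> T2) (r : seq T1) :
  uniq (map g r) -> {in r &, injective g}.
Proof.
elim: r => // x r IH /= /andP[xr ur] y z; rewrite !inE.
case/predU1P=> [->|yr] /predU1P[->|zr] E //; last exact: IH.
  by rewrite E map_f in xr.
by rewrite -E map_f in xr.
Qed.

Section Isog.
Variables (m n : nat) (P : seq (seq nat * seq nat)).
Hypotheses (g1 : is_tab_group m (unzip1 P)) (g2 : is_tab_group n (unzip2 P)).
Hypothesis PM :
  all (fun x => all (fun y => (tmul x.1 y.1, tmul x.2 y.2) \in P) P) P.

Let f (s : 'S_m) : 'S_n := odflt 1 [pick r : 'S_n | (tab s, tab r) \in P].

Let fP s : s \in tab_group g1 -> (tab s, tab (f s)) \in P.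
Proof.
rewrite inE => /mapP[[t u] tuP /= E]; rewrite /f; case: pickP => [//|] /=.
have uT : u \in unzip2 P by apply/mapP; exists (t, u).
have /and4P[v2 _ _ _] := g2.
by have [r Er] := is_tabP (allP v2 _ uT) => /(_ r); rewrite E Er tuP.
Qed.

Let unzip1_inj : {in P &, injective fst}.
Proof. by apply: uniq_map_inj; case/and4P: g1. Qed.

Let unzip2_inj : {in P &, injective snd}.
Proof. by apply: uniq_map_inj; case/and4P: g2. Qed.

Let fM : {in tab_group g1 &, {morph f : s w / s * w}}.
Proof.
move=> s w sG wG; apply: tab_inj; rewrite tabM.
have E := allP (allP PM _ (fP sG)) _ (fP wG).
by have [] := unzip1_inj (fP (groupM sG wG)) E (tabM s w).
Qed.

(** [P] is the graph of the isomorphism: uniqueness of first components makes it a function, closure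
    under componentwise products makes [f] a morphism, uniqueness of second components makes it
    injective, and both groups have as many elements as [P]. *)
Lemma tab_group_isog : tab_group g1 \isog tab_group g2.
Proof.
have injf : 'injm (Morphism fM).
  apply/injmP=> s w sG wG /= E; apply: tab_inj.
  by have [] := unzip2_inj (fP sG) (fP wG) (congr1 (@tab n) E).
apply: (isom_isog (Morphism fM)) => //; apply/isomP; split=> //.
apply/eqP; rewrite eqEcard; apply/andP; split.
  apply/subsetP=> _ /morphimP[s _ sG ->]; rewrite /= inE.
  by apply/mapP; exists (tab s, tab (f s)) => //; apply: fP.
by rewrite card_injm // !card_tab_group !size_map.
Qed.
End Isog.

Lemma tab_group_Sym n (T : seq (seq nat)) (gT : is_tab_group n T) :
  size T = n`! -> tab_group gT = 'Sym_('I_n) :> {set _}.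
Proof.
move=> sT; apply/eqP; rewrite eqEcard subsetT card_tab_group sT.
by rewrite /= cardsT card_Sn.
Qed.

(* Squares are even, so a subgroup all of whose elements are products of two
   squares lies in the alternating group. *)
Lemma tab_group_Alt n (T : seq (seq nat)) (gT : is_tab_group n T) :
  1 < n -> (2 * size T)%N = n`! ->
  all (fun t => has (fun u => has (fun v => tmul (tmul u u) (tmul v v) == t) T)
                    T) T ->
  tab_group gT = 'Alt_('I_n) :> {set _}.
Proof.
move=> n1 sT sq; apply/eqP; rewrite eqEcard card_tab_group; apply/andP; split.
  apply/subsetP=> s sG; rewrite Alt_even; rewrite inE in sG.
  have /hasP[u uT /hasP[v vT /eqP E]] := allP sq _ sG.
  have /and4P[vldT _ _ _] := gT.
  have [x Ex] := is_tabP (allP vldT _ uT).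
  have [y Ey] := is_tabP (allP vldT _ vT).
  have -> : s = x * x * (y * y) by apply: tab_inj; rewrite !tabM Ex Ey.
  by rewrite !odd_permM !addbb.
by rewrite -(leq_pmul2l (m := 2)) // sT card_Alt ?card_ord.
Qed.

(** * Binary codes of point sets *)

Definition bit i (b : bitseq) := nth false b i.
Definition xor (x y : bitseq) : bitseq := [seq u.1 (+) u.2 | u <- zip x y].
Definition meet (x y : bitseq) := count (fun u => u.1 && u.2) (zip x y).
Definition weight (x : bitseq) := count id x.
Definition relabel (t : seq nat) (b : bitseq) : bitseq := [seq bit j b | j <- t].
(** Here [s] acts as a labelling: position [i] of the code stands for the point [s i]. Relabelling
    by [w] replaces [s] by [w * s]. *)
Definition code n (s : 'S_n) (X : {set 'I_n}) : bitseq :=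
  [seq s i \in X | i <- enum 'I_n].

Section Codes.
Variable n : nat.
Implicit Types (s w : 'S_n) (X Y : {set 'I_n}).

Lemma size_code s X : size (code s X) = n.
Proof. by rewrite size_map size_enum_ord. Qed.

Lemma bit_code s X (i : 'I_n) : bit i (code s X) = (s i \in X).
Proof. by rewrite /bit (nth_map i) ?size_enum_ord ?nth_ord_enum. Qed.

Lemma code_inj s : injective (code s).
Proof.
by move=> X Y E; apply/setP=> i; rewrite -[i](permKV s) -!bit_code E.
Qed.

Lemma code_surj s (b : bitseq) : size b = n -> exists X, code s X = b.
Proof.
move=> sb; exists [set i | bit (s^-1 i) b].
apply: (@eq_from_nth _ false); rewrite size_code // => i li.
by rewrite -/(bit i _) (bit_code s _ (Ordinal li)) inE permK.
Qed.

Lemma code_symdiff s X Y : code s (symdiff X Y) = xor (code s X) (code s Y).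
Proof.
rewrite /xor /code zip_map -map_comp; apply: eq_map => i /=.
by rewrite !inE; case: (_ \in X); case: (_ \in Y).
Qed.

Lemma count_perm s X : count (fun i => s i \in X) (enum 'I_n) = #|X|.
Proof.
rewrite -[RHS](card_preimset X (@perm_inj _ s)) -sum1_count big_enum_cond.
by rewrite sum1_card; apply: eq_card => i; rewrite !inE.
Qed.

Lemma weight_code s X : weight (code s X) = #|X|.
Proof. by rewrite /weight count_map -(count_perm s); apply: eq_count. Qed.

Lemma meet_code s X Y : meet (code s X) (code s Y) = #|X :&: Y|.
Proof.
rewrite /meet /code zip_map count_map -(count_perm s).
by apply: eq_count => i; rewrite /= inE.
Qed.

Lemma code_mul w s X : code (w * s) X = relabel (tab w) (code s X).
Proof.
rewrite /relabel /tab -map_comp; apply: eq_map => i /=.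
by rewrite bit_code permM.
Qed.
End Codes.

(** * Backtracking search for relabellings between two lists of codes *)

Definition groups := seq (seq bitseq * seq bitseq).

(* A state of the search for a table t with relabel t l2 = l1 (as sets): pairs of
   sublists of l1 and l2, the second of which must be mapped to the first. *)
Definition split_groups i j (gs : groups) : groups :=
  (* In a balanced state an empty first list has an empty partner, so the pair imposes nothing
     more. *)
  flatten [seq (if g.1 is [::] then [::] else
                [:: ([seq b <- g.1 | bit i b], [seq b <- g.2 | bit j b]);
                    ([seq b <- g.1 | ~~ bit i b], [seq b <- g.2 | ~~ bit j b])])
          | g <- gs].

Definition balanced (gs : groups) := all (fun g => size g.1 == size g.2) gs.

(** Balance is only a necessary condition, and repeated values are not excluded: the output need
    only include the prefixes of all compatible tables. *)
Fixpoint extend n k i (gs : groups) (t : seq nat) : seq (seq nat) :=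
  if k is k'.+1 then
    flatten [seq (let gs' := split_groups i j gs in
                  if balanced gs' then extend n k' i.+1 gs' (rcons t j)
                  else [::])
            | j <- iota 0 n]
  else [:: t].

Definition compatible u (gs : groups) :=
  all (fun g => perm_eq g.1 (map (relabel u) g.2)) gs.

(** Bit [i] of [relabel u b] is bit [nth 0 u i] of [b], so splitting the two lists by these bits
    commutes with relabelling. *)
Lemma compatible_split u gs i :
  i < size u -> compatible u gs -> compatible u (split_groups i (nth 0 u i) gs).
Proof.
move=> iu /allP H; apply/allP=> g /flattenP[r /mapP[[g1 g2] /H /= gH ->]].
have E : {mono relabel u : b / bit (nth 0 u i) b >-> bit i b}.
  by move=> b; rewrite {1}/bit /relabel (nth_map 0).
case: g1 gH => // b g1 gH; rewrite !inE => /orP[] /eqP-> /=.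
  rewrite (perm_trans (perm_filter (bit i) gH)) // filter_map.
  by rewrite (eq_filter (a2 := bit (nth 0 u i))) // => c; apply: E.
rewrite (perm_trans (perm_filter (predC (bit i)) gH)) // filter_map.
by rewrite (eq_filter (a2 := predC (bit (nth 0 u i)))) // => c; rewrite /= E.
Qed.

Lemma compatible_balanced u gs : compatible u gs -> balanced gs.
Proof.
move=> /allP H; apply/allP=> g /H /perm_size ->; by rewrite size_map.
Qed.

(** Completeness of the search: choosing the value [nth 0 u i] at position [i] keeps [u] compatible,
    hence the state balanced, so this branch is never cut. *)
Lemma mem_extend n u k i gs :
  all (ltn^~ n) u -> i + k <= size u -> compatible u gs ->
  take (i + k) u \in extend n k i gs (take i u).
Proof.
move=> un; elim: k i gs => [|k IH] i gs; first by rewrite addn0 inE.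
rewrite addnS -addSn => iu cu; have iu' : i < size u.
  by apply: leq_trans iu; rewrite leq_addr.
have cu' := compatible_split iu' cu.
apply/flattenP; exists (extend n k i.+1 (split_groups i (nth 0 u i) gs) (take i.+1 u)).
  apply/mapP; exists (nth 0 u i).
    by rewrite mem_iota /= add0n; apply: (allP un); apply: mem_nth.
  by rewrite /= (compatible_balanced cu') (take_nth 0).
exact: IH.
Qed.

Lemma compatible_fix u l k :
  k <= size u -> (forall i, i < k -> nth 0 u i = i) ->
  perm_eq l (map (relabel u) l) ->
  compatible u (foldl (fun gs i => split_groups i i gs) [:: (l, l)] (iota 0 k)).
Proof.
move=> ku H lu; elim: k ku H => [|k IH] ku H; first by rewrite /= /compatible /= lu.
rewrite -addn1 iotaD foldl_cat /= add0n.
rewrite -{2}(H k) //; apply: compatible_split => //.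
by apply: IH; [exact: ltnW | move=> i ik; apply: H; apply: ltnW].
Qed.

(** * Automorphisms of a list of codes *)

Section Automorphisms.
Variables (n : nat) (l : seq bitseq).
Implicit Types (s w : 'S_n).

Definition code_aut : {set 'S_n} := [set w | perm_eq l (map (relabel (tab w)) l)].

Lemma tab_lt s : all (ltn^~ n) (tab s).
Proof. by apply/allP=> _ /mapP[i _ ->]; apply: ltn_ord. Qed.

Hypotheses (ul : uniq l) (sl : all (fun b => size b == n) l).

Let sl_surj s b : b \in l -> exists X, code s X = b.
Proof. by move=> bl; apply: code_surj; apply/eqP/(allP sl). Qed.

Lemma code_autM s w : s \in code_aut -> w \in code_aut -> s * w \in code_aut.
Proof.
rewrite !inE => ps pw; apply: (perm_trans ps).
suff -> : map (relabel (tab (s * w))) l =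
    map (relabel (tab s)) (map (relabel (tab w)) l).
  exact: perm_map.
rewrite -map_comp; apply/eq_in_map => b /(sl_surj 1)[X <-] /=.
by rewrite -!code_mul mulgA.
Qed.

(** Relabelling by a permutation is injective on codes of length [n], so mapping [l] into itself
    already means permuting it. *)
Lemma code_autP w : reflect {in l, forall b, relabel (tab w) b \in l} (w \in code_aut).
Proof.
rewrite inE; apply: (iffP idP) => [pl b bl | H].
  by rewrite (perm_mem pl) map_f.
have um : uniq (map (relabel (tab w)) l).
  rewrite map_inj_in_uniq // => b c /(sl_surj 1)[X <-] /(sl_surj 1)[Y <-].
  by rewrite -!code_mul => /code_inj ->.
rewrite perm_sym; apply: uniq_perm => //.
apply: (uniq_min_size um _ _).2; last by rewrite size_map.
by move=> _ /mapP[b bl ->]; apply: H.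
Qed.

Lemma code_aut_group_set : group_set code_aut.
Proof.
apply/group_setP; split; last exact: code_autM.
by apply/code_autP=> b bl; have [X E] := sl_surj 1 bl; rewrite -E -code_mul mulg1 E.
Qed.
Let A := Group code_aut_group_set.

(** By [rigid], an automorphism fixing the first [k] labels is trivial. Hence automorphisms are
    separated by their first [k] values, and every such prefix occurs in the output of the
    search. *)
Lemma card_code_aut k :
  k <= n ->
  extend n (n - k) k
    (foldl (fun gs i => split_groups i i gs) [:: (l, l)] (iota 0 k)) (iota 0 k)
    = [:: iota 0 n] ->
  #|code_aut| <= size (extend n k 0 [:: (l, l)] [::]).
Proof.
move=> kn rigid.
have stab w : w \in A -> (forall i : 'I_n, i < k -> w i = i) -> w = 1.
  rewrite inE => wA fw; apply: tab_inj; rewrite tab1.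
  have fw' i : i < k -> nth 0 (tab w) i = i.
    move=> ik; have li := leq_trans ik kn.
    by rewrite (nth_tab w (Ordinal li)) fw.
  have -> : tab w = take (k + (n - k)) (tab w).
    by rewrite take_oversize // size_tab subnKC.
  apply/eqP; rewrite -mem_seq1 -rigid.
  have Ek : take k (tab w) = iota 0 k.
    apply: (@eq_from_nth _ 0); rewrite ?size_iota size_takel ?size_tab // => i ik.
    by rewrite nth_take // fw' // nth_iota.
  rewrite -{2}Ek; apply: mem_extend; rewrite ?tab_lt ?size_tab ?subnKC //.
  have kt : k <= size (tab w) by rewrite size_tab.
  exact: (compatible_fix kt fw' wA).
have inj : {in A &, injective (fun w => take k (tab w))}.
  move=> w v wA vA /= E; apply/eqP; rewrite eq_mulgV1; apply/eqP.
  apply: stab => [|i ik]; first by rewrite groupM ?groupV.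
  rewrite permM; apply: (perm_inj (s := v)); rewrite permKV.
  by apply: val_inj; rewrite /= -!nth_tab -(nth_take 0 ik) E nth_take.
rewrite cardE -(size_map (fun w => take k (tab w))); apply: uniq_leq_size.
  by rewrite map_inj_in_uniq ?enum_uniq // => w v; rewrite !mem_enum; apply: inj.
move=> _ /mapP[w wA ->]; rewrite mem_enum in wA.
have := @mem_extend n (tab w) k 0 [:: (l, l)] (tab_lt w).
rewrite take0 add0n size_tab; apply=> //.
by rewrite inE in wA; rewrite /compatible /= wA.
Qed.
End Automorphisms.

Lemma design_aut_code n (B : {set {set 'I_n}}) (s : 'S_n) (l : seq bitseq) :
  uniq l -> all (fun b => size b == n) l ->
  (forall X, (X \in B) = (code s X \in l)) ->
  design_aut B = code_aut n l :^ s :> {set _}.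
Proof.
move=> ul sl BE; apply/setP=> u; rewrite mem_conjg -groupV.
(* Position [i] of the left-hand code tests whether [u (s i)] lies in [X], and [s * u] equals
   [u ^ s^-1 * s]. *)
have codeV (X : {set 'I_n}) :
    code s (u^-1 @: X) = relabel (tab (u ^ s^-1)) (code s X).
  rewrite -code_mul conjgE invgK !mulgA mulgKV.
  apply/eq_map => i; rewrite permM -{1}[s i](permK u) mem_imset //.
  exact: perm_inj.
apply/idP/(code_autP ul sl) => [uB b bl | H].
  have [X E] := code_surj s (eqP (allP sl _ bl)).
  rewrite -E -codeV -BE; have := astabs_act X uB; rewrite /= /setact.
  by move: bl; rewrite -E -BE => -> //.
rewrite !inE; apply/subsetP=> X; rewrite inE BE => /H.
by rewrite -codeV -BE.
Qed.

(** * Search for completions to a design *)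

(* search returns every set of 15 codes that contains known, is closed under ext,
   meets pairwise in 4 and is otherwise drawn from cands.  The number k bounds the
   recursion depth. *)
Section Search.
Variable ext : bitseq -> seq bitseq.

Fixpoint search k (known cands : seq bitseq) : seq (seq bitseq) :=
  if size known == 15 then [:: known] else
  if k is k'.+1 then
    if cands is c :: cs then
      if size known + size cands < 15 then [::] else
      let new := undup [seq x <- ext c | x \notin known] in
      (* A block forced by [c] that is neither known nor a candidate has been excluded before, so
         [c] cannot be chosen. *)
      (if all (mem cands) new then
         search k' (new ++ known)
           [seq y <- cs | all (fun x => meet x y == 4) new]
       else [::]) ++ search k' known cs
    else [::]
  else [::].

(** The invariant is that [l] contains [known] and is contained in [known ++ cands]. If the next
    candidate [c] lies in [l], so does [ext c], and the first branch preserves the invariant;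
    otherwise the second does. *)
Lemma search_complete (l : seq bitseq) :
  size l = 15 -> uniq l -> {in l &, forall x y, x != y -> meet x y = 4} ->
  {in l, forall x, x \in ext x /\ {subset ext x <= l}} ->
  forall k known cands, size cands <= k ->
  uniq known -> {subset known <= l} -> {subset l <= known ++ cands} ->
  exists2 r, r \in search k known cands & perm_eq r l.
Proof.
move=> sl ul ml el; elim=> [|k IH] known cands sc uk kl lk /=.
  have pk : perm_eq known l.
    move: sc lk; case: cands => // _; rewrite cats0 => lk.
    by apply: uniq_perm => // x; apply/idP/idP; [exact: kl | exact: lk].
  by exists known; rewrite // (perm_size pk) sl inE.
case: ifP => [/eqP sk|sk].
  exists known; rewrite ?inE //; apply: uniq_perm => //.
  by apply: (uniq_min_size uk kl _).2; rewrite sk sl.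
have := uniq_leq_size ul lk; rewrite size_cat sl.
case: cands sc lk => [|c cs] sc lk.
  rewrite cats0 in lk; have := uniq_leq_size ul lk.
  have := uniq_leq_size uk kl; rewrite sl => a b.
  by move: sk; rewrite eqn_leq a b.
rewrite leqNgt => /negbTE-> /=.
set new := undup _.
have [cl|cl] := boolP (c \in l); last first.
  case: (IH known cs) => //.
    move=> x xl; have := lk _ xl; rewrite !mem_cat inE.
    by case: eqP => // E; rewrite -E xl in cl.
  by move=> r rs pr; exists r; rewrite // mem_cat rs orbT.
have [cc ecl] := el _ cl.
have nl x : x \in new -> x \in l.
  by rewrite mem_undup mem_filter => /andP[_ /ecl].
have nc : all (mem (c :: cs)) new.
  apply/allP=> x xn; have := lk _ (nl _ xn); rewrite mem_cat.
  by move: xn; rewrite mem_undup mem_filter => /andP[/negbTE-> _].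
rewrite nc; case: (IH (new ++ known) [seq y <- cs | all (fun x => meet x y == 4) new]).
- by rewrite size_filter; apply: leq_trans (count_size _ _) _.
- rewrite cat_uniq undup_uniq uk andbT /=; apply/hasPn=> x xk.
  by rewrite mem_undup mem_filter xk.
- by move=> x; rewrite mem_cat => /orP[/nl | /kl].
- move=> x xl; rewrite !mem_cat; case xn: (x \in new) => //=.
  case xk: (x \in known) => //=; rewrite mem_filter; apply/andP; split.
    apply/allP=> y yn; rewrite ml ?(nl y) //.
    by apply/eqP=> E; rewrite -E yn in xn.
  have := lk _ xl; rewrite mem_cat xk inE /=; case: eqP => // E.
  by move: xn; rewrite mem_undup mem_filter xk E cc.
by move=> r rs pr; exists r; rewrite // mem_cat rs.
Qed.
End Search.

Fixpoint bitseqs n : seq bitseq :=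
  if n is k.+1 then map (cons true) (bitseqs k) ++ map (cons false) (bitseqs k)
  else [:: [::]].

Definition candidates (known : seq bitseq) : seq bitseq :=
  [seq x <- bitseqs 15 | (weight x == 8) && all (fun y => meet x y == 4) known].

(* The first member of extend; it need not be correct, since isomorphic checks it. *)
Fixpoint first_extension n k i (gs : groups) (t : seq nat) : seq nat :=
  if k is k'.+1 then
    (fix try js := if js is j :: js' then
       let gs' := split_groups i j gs in
       if balanced gs' then
         if first_extension n k' i.+1 gs' (rcons t j) is x :: r then x :: r
         else try js'
       else try js'
     else [::]) (iota 0 n)
  else t.

Definition isomorphic (l0 l : seq bitseq) :=
  let t := first_extension 15 15 0 [:: (l0, l)] [::] in
  is_tab 15 t && perm_eq l0 (map (relabel t) l).

(** Completions failing [cond] are passed over, since they do not arise from the type considered. *)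
Definition classified ext known (cond : pred (seq bitseq)) l0 :=
  let cands := candidates known in
  all (fun l => if cond l then isomorphic l0 l else true)
      (search ext (size cands) known cands).

(** * Standard position and the explicit designs *)

Definition block (r : seq nat) : bitseq := [seq i \in r | i <- iota 0 15].
(* Label i stands for the nonzero vector of F_2^4 with binary expansion i + 1. *)
Definition coord k : bitseq := [seq odd (v %/ 2 ^ k) | v <- iota 1%N 15].
Definition cA := Eval compute in coord 0.
Definition cB := Eval compute in coord 1.
Definition cC := Eval compute in coord 2.
Definition cD := Eval compute in coord 3.
(** Codes are Boolean functions on the nonzero vectors; products of coordinates supply the quadratic
    terms of nonlinear blocks. *)
Definition mulb (x y : bitseq) : bitseq := [seq u.1 && u.2 | u <- zip x y].

Definition std_fano := Eval compute in
  [:: cA; cB; xor cA cB; cC; xor cA cC; xor cB cC; xor (xor cA cB) cC].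
Definition std_lines := Eval compute in [:: cA; cB; xor cA cB; cC; xor cA cC].

(** The zero sum, which arises when [x] is in [r], is not a block and is dropped. *)
Definition translates (r : seq bitseq) x :=
  [seq y <- [seq xor z x | z <- r] | has id y].
Definition zero := Eval compute in nseq 15 false.

(** The blocks that a further block forces: for (C2) its sums with the common line, for (C3) and
    (C4) its sum with the distinguished point, for (NC) none. *)
Definition ext_line := translates [:: zero; cA; cB; xor cA cB].
Definition ext_point := translates [:: zero; cA].
Definition ext_self x : seq bitseq := [:: x].

(* Necessary conditions for a design to be of the given type once the Fano plane
   (or, for (C4), the distinguished point cA) is in standard position. *)
Definition cond_C2 (l : seq bitseq) :=
  has (fun x => has (fun y => (x != y) && (xor x y \notin l)) l) l.
Definition cond_C3 (l : seq bitseq) :=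
  all (fun x => all (fun y => (xor x y \notin l))
                    [seq y <- std_fano | y != cA])
      [seq x <- l | x \notin std_fano].
Definition cond_NC (l : seq bitseq) :=
  all (fun x => all (fun y => (xor x y \notin l)) l)
      [seq x <- l | x \notin std_fano].
Definition cond_C4 (l : seq bitseq) :=
  all (fun x => all (fun y => (xor x y == cA) || (xor x y \notin l))
                    [seq y <- l | y != cA])
      [seq x <- l | x != cA].

(** In coordinates a, b, c, d, the three planes are spanned by a and b together with c, d and c + d
    + ab respectively. *)
Definition des_C2 : seq bitseq := Eval compute in
  std_fano ++ ext_line cD ++ ext_line (xor (xor cC cD) (mulb cA cB)).
(** Each [ext_point] yields the two points other than [cA] of one of the four lines. *)
Definition des_C3 : seq bitseq := Eval compute in
  let g := xor (mulb cA cB) (xor cC cD) in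
  let h := xor (mulb cA cC) (xor cB (xor cC cD)) in
  std_fano ++ ext_point cD ++ ext_point g ++ ext_point h ++
  ext_point (xor cD (xor g h)).

(* In the next two designs the labels are two copies of Z/7 and one more point,
   and [:: 0; 3; 5; 6] is the complement of the line {1, 2, 4} of the Fano plane
   on Z/7.  Translations and doubling generate the subgroup of order 21. *)
Definition shift r i := [seq (x + i) %% 7 | x <- r].
Definition des_C4 : seq bitseq := Eval compute in
  let even := map double in
  let odd := map (fun x => x.*2.+1) in
  let p := block (14 :: odd (iota 0 7)) in
  p :: flatten [seq (let x := block (14 :: odd (shift [:: 3; 5; 6] i) ++
                                     even (shift [:: 0; 3; 5; 6] i)) in
                [:: x; xor p x]) | i <- iota 0 7].
Definition des_NC : seq bitseq := Eval compute in
  let twice r := block (r ++ map (addn 7) r) in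
  let d := block (14 :: iota 0 7) in
  [seq twice (shift [:: 0; 3; 5; 6] i) | i <- iota 0 7] ++
  d :: [seq xor d (twice (shift [:: 0; 1%N; 2; 4] i)) | i <- iota 0 7].

(** * Generators of the automorphism groups *)

Fixpoint closure (T : eqType) (op : T -> T -> T) k (gs r : seq T) : seq T :=
  if k is k'.+1 then
    closure op k' gs (undup (r ++ [seq op t g | t <- r, g <- gs]))
  else r.
(** That [k] rounds suffice to reach a group is verified afterwards through [is_tab_group]. *)
Definition generated n k gs := closure tmul k gs [:: iota 0 n].
Definition generated_pairs m n k (gs : seq (seq nat * seq nat)) :=
  closure (fun x y => (tmul x.1 y.1, tmul x.2 y.2)) k gs
          [:: (iota 0 m, iota 0 n)].

(* The first component says that only the identity fixes the first k points; the
   second counts the candidates for their images. *)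
Definition aut_bound n k l :=
  (extend n (n - k) k
    (foldl (fun gs i => split_groups i i gs) [:: (l, l)] (iota 0 k)) (iota 0 k)
    == [:: iota 0 n], size (extend n k 0 [:: (l, l)] [::])).

Definition sdprod_check n (TN TH : seq (seq nat)) :=
  all (fun h => all (fun x => tmul (tmul (tinv n h) x) h \in TN) TN) TH &&
  all (fun h => (h \in TN) ==> (h == iota 0 n)) TH.

Definition preserves l (T : seq (seq nat)) :=
  all (fun t => all (fun b => relabel t b \in l) l) T.

(** The two subgroups bound the automorphism group from below, the count of [aut_bound] bounds it
    from above. *)
Lemma code_aut_sdprod n k l TN TH (gN : is_tab_group n TN)
    (gH : is_tab_group n TH) :
  k <= n -> uniq l && all (fun b => size b == n) l ->
  aut_bound n k l = (true, size TN * size TH)%N ->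
  preserves l TN -> preserves l TH -> sdprod_check n TN TH ->
  tab_group gN ><| tab_group gH = code_aut n l.
Proof.
move=> kn /andP[ul sl] [/eqP rigid sz] pN pH /andP[nNH tiNH].
have sub T (gT : is_tab_group n T) : preserves l T -> tab_group gT \subset code_aut n l.
  move=> pT; apply/subsetP=> s; rewrite inE => sT; apply/(code_autP ul sl) => b bl.
  exact: (allP (allP pT _ sT)).
apply: tab_group_sdprod => //; rewrite ?sub //.
  by move=> s w; apply: code_autM.
by rewrite -sz; apply: card_code_aut rigid.
Qed.

(** On vectors, these are the maps v -> v + a(v) w, where a is the first coordinate and a(w) = 0. *)
Definition N_C3 := Eval vm_compute in generated 15 3
 [:: [:: 2; 1%N; 0; 3; 6; 5; 4; 7; 10; 9; 8; 11; 14; 13; 12];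
     [:: 4; 1%N; 6; 3; 0; 5; 2; 7; 12; 9; 14; 11; 8; 13; 10];
     [:: 8; 1%N; 10; 3; 12; 5; 14; 7; 0; 9; 2; 11; 4; 13; 6]].
(* The second components are the images under an isomorphism onto 'Alt_('I_4); the
   lists of pairs for des_C2 encode isomorphisms onto symmetric groups. *)
Definition H_C3 := Eval vm_compute in generated_pairs 15 4 5
 [:: ([:: 0; 3; 4; 5; 6; 1%N; 2; 7; 8; 11; 12; 13; 14; 9; 10], [:: 0; 2; 3; 1%N]);
     ([:: 10; 3; 6; 13; 4; 9; 8; 7; 2; 11; 14; 5; 12; 1%N; 0], [:: 1%N; 3; 2; 0])].

(** Translation by 1 on both copies of Z/7, which are the even and the odd labels here and the
    labels 0 to 6 and 7 to 13 for [aff_NC]; [dbl_C4] and [dbl_NC] are the doublings. *)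
Definition aff_C4 := [:: 2; 3; 4; 5; 6; 7; 8; 9; 10; 11; 12; 13; 0; 1%N; 14].
Definition dbl_C4 := [:: 0; 1%N; 4; 5; 8; 9; 12; 13; 2; 3; 6; 7; 10; 11; 14].
(** This group fixes the seven even labels and is regular on the other eight, which form the first
    block of [des_C4]. *)
Definition N_C4 := Eval vm_compute in generated 15 3
 [:: [:: 0; 3; 2; 1%N; 4; 9; 6; 13; 8; 5; 10; 14; 12; 7; 11];
     [:: 0; 5; 2; 9; 4; 1%N; 6; 14; 8; 3; 10; 13; 12; 11; 7];
     [:: 0; 7; 2; 13; 4; 14; 6; 1%N; 8; 11; 10; 9; 12; 3; 5]].
Definition aff_NC := [:: 1%N; 2; 3; 4; 5; 6; 0; 8; 9; 10; 11; 12; 13; 7; 14].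
Definition dbl_NC := [:: 0; 2; 4; 6; 1%N; 3; 5; 7; 9; 11; 13; 8; 10; 12; 14].
(** Each nontrivial element interchanges x and x + 7 for x in a translate of {0, 1, 2, 4} modulo
    7. *)
Definition N_NC := Eval vm_compute in generated 15 3
 [:: [:: 0; 1%N; 9; 10; 11; 5; 13; 7; 8; 2; 3; 4; 12; 6; 14];
     [:: 0; 8; 2; 3; 11; 12; 13; 7; 1%N; 9; 10; 4; 5; 6; 14];
     [:: 7; 1%N; 2; 10; 11; 12; 6; 0; 8; 9; 3; 4; 5; 13; 14]].

(** On vectors, these are the maps v -> v + b(v) w, where b is the second coordinate and w lies in
    the span of the last two basis vectors. *)
Definition V_C2 := Eval vm_compute in generated 15 2
 [:: [:: 0; 5; 6; 3; 4; 1%N; 2; 7; 8; 13; 14; 11; 12; 9; 10];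
     [:: 0; 9; 10; 3; 4; 13; 14; 7; 8; 1%N; 2; 11; 12; 5; 6]].
Definition S_C2 := Eval vm_compute in generated_pairs 15 4 6
 [:: ([:: 4; 1%N; 6; 7; 12; 9; 14; 3; 0; 5; 2; 11; 8; 13; 10], [:: 1%N; 2; 3; 0]);
     ([:: 12; 9; 14; 11; 0; 5; 2; 7; 4; 1%N; 6; 3; 8; 13; 10], [:: 1%N; 3; 0; 2])].
Definition N_C2 := Eval vm_compute in [seq tmul t u | t <- V_C2, u <- unzip1 S_C2].
Definition H_C2 := Eval vm_compute in generated_pairs 15 3 3
 [:: ([:: 5; 14; 8; 3; 1%N; 10; 12; 7; 13; 6; 0; 11; 9; 2; 4], [:: 1%N; 2; 0]);
     ([:: 5; 4; 2; 3; 1%N; 0; 6; 7; 13; 12; 10; 11; 9; 8; 14], [:: 0; 2; 1%N])].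

(** * Structure of the four automorphism groups *)

Lemma N_C2_group : is_tab_group 15 N_C2.
Proof. vm_cast_no_check (erefl true). Qed.

Lemma H_C2_group : is_tab_group 15 (unzip1 H_C2).
Proof. vm_cast_no_check (erefl true). Qed.

Lemma H_C2_group3 : is_tab_group 3 (unzip2 H_C2).
Proof. vm_cast_no_check (erefl true). Qed.

Lemma V_C2_group : is_tab_group 15 V_C2.
Proof. vm_cast_no_check (erefl true). Qed.

Lemma S_C2_group : is_tab_group 15 (unzip1 S_C2).
Proof. vm_cast_no_check (erefl true). Qed.

Lemma S_C2_group4 : is_tab_group 4 (unzip2 S_C2).
Proof. vm_cast_no_check (erefl true). Qed.

Lemma sdprod_C2 : tab_group N_C2_group ><| tab_group H_C2_group = code_aut 15 des_C2.
(* Only the identity fixes the first [4] labels; the other three designs use 8, 6 and 5 labels. *)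
Proof. by apply: (@code_aut_sdprod _ 4); vm_compute. Qed.

Lemma sdprod_N_C2 :
  tab_group V_C2_group ><| tab_group S_C2_group = tab_group N_C2_group.
Proof. by apply: tab_group_TI_sdprod; vm_compute. Qed.

Lemma isog_S_C2 : tab_group S_C2_group \isog 'Sym_('I_4).
Proof.
rewrite -(tab_group_Sym S_C2_group4); last by [].
by apply: tab_group_isog; vm_compute.
Qed.

Lemma isog_H_C2 : tab_group H_C2_group \isog 'Sym_('I_3).
Proof.
rewrite -(tab_group_Sym H_C2_group3); last by [].
by apply: tab_group_isog; vm_compute.
Qed.

Lemma isog_V_C2 : tab_group V_C2_group \isog C2_pow2.
Proof.
apply: isog_C2_pow2; last by rewrite card_tab_group.
by apply: tab_group_abelem2; vm_compute.
Qed.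

Lemma code_aut_C2 : exists N H : {group 'S_15},
  [/\ N ><| H = code_aut 15 des_C2,
      is_semidirect N C2_pow2 'Sym_('I_4) & H \isog 'Sym_('I_3)].
Proof.
exists (tab_group N_C2_group), (tab_group H_C2_group).
split; [exact: sdprod_C2 | | exact: isog_H_C2].
exists (tab_group V_C2_group), (tab_group S_C2_group).
by split; [exact: sdprod_N_C2 | exact: isog_V_C2 | exact: isog_S_C2].
Qed.

Lemma N_C3_group : is_tab_group 15 N_C3.
Proof. vm_cast_no_check (erefl true). Qed.

Lemma H_C3_group : is_tab_group 15 (unzip1 H_C3).
Proof. vm_cast_no_check (erefl true). Qed.

Lemma H_C3_group4 : is_tab_group 4 (unzip2 H_C3).
Proof. vm_cast_no_check (erefl true). Qed.

Lemma sdprod_C3 : tab_group N_C3_group ><| tab_group H_C3_group = code_aut 15 des_C3.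
Proof. by apply: (@code_aut_sdprod _ 8); vm_compute. Qed.

Lemma isog_N_C3 : tab_group N_C3_group \isog C2_pow3.
Proof.
apply: isog_C2_pow3; last by rewrite card_tab_group.
by apply: tab_group_abelem2; vm_compute.
Qed.

Lemma isog_H_C3 : tab_group H_C3_group \isog 'Alt_('I_4).
Proof.
rewrite -(tab_group_Alt H_C3_group4); [|by []|by []|by vm_compute].
by apply: tab_group_isog; vm_compute.
Qed.

Lemma code_aut_C3 : exists N H : {group 'S_15},
  [/\ N ><| H = code_aut 15 des_C3, N \isog C2_pow3 & H \isog 'Alt_('I_4)].
Proof.
exists (tab_group N_C3_group), (tab_group H_C3_group).
by split; [exact: sdprod_C3 | exact: isog_N_C3 | exact: isog_H_C3].
Qed.

(** The generators [x] and [y] themselves witness that the group of order 21 is not abelian. *)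
Lemma tab_group_C7_rtimes_C3 (x y : seq nat) :
  let T7 := generated 15 7 [:: x] in
  let T3 := generated 15 3 [:: y] in
  let TH := [seq tmul t u | t <- T7, u <- T3] in
  [&& is_tab_group 15 T7, is_tab_group 15 T3, (size T7, size T3) == (7, 3),
      all (mem TH) (T7 ++ T3), size TH == (size T7 * size T3)%N,
      sdprod_check 15 T7 T3, x \in T7, y \in T3 & tmul x y != tmul y x] ->
  forall gH : is_tab_group 15 TH, is_C7_rtimes_C3 (tab_group gH).
Proof.
move=> T7 T3 TH /and5P[g7 g3 /eqP[s7 s3] sub]; case/and5P=> /eqP sz /andP[nm ti].
move=> xT yT xy gH; split.
  exists (tab_group g7), (tab_group g3); split.
  - exact: tab_group_TI_sdprod.
  - by apply: isog_Zp_prime; rewrite // card_tab_group.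
  - by apply: isog_Zp_prime; rewrite // card_tab_group.
rewrite all_cat in sub; case/andP: sub => /allP sub7 /allP sub3.
apply: contra xy => /centsP ab.
have /and4P[v7 _ _ _] := g7; have /and4P[v3 _ _ _] := g3.
have [u Eu] := is_tabP (allP v7 _ xT); have [v Ev] := is_tabP (allP v3 _ yT).
rewrite -Eu -Ev -!tabM; apply/eqP; congr tab; apply: ab.
  by rewrite inE Eu; apply: sub7.
by rewrite inE Ev; apply: sub3.
Qed.

Definition H_C4 := Eval vm_compute in
  [seq tmul t u | t <- generated 15 7 [:: aff_C4], u <- generated 15 3 [:: dbl_C4]].
Definition H_NC := Eval vm_compute in
  [seq tmul t u | t <- generated 15 7 [:: aff_NC], u <- generated 15 3 [:: dbl_NC]].

Lemma N_C4_group : is_tab_group 15 N_C4.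
Proof. vm_cast_no_check (erefl true). Qed.

Lemma H_C4_group : is_tab_group 15 H_C4.
Proof. vm_cast_no_check (erefl true). Qed.

Lemma sdprod_C4 : tab_group N_C4_group ><| tab_group H_C4_group = code_aut 15 des_C4.
Proof. by apply: (@code_aut_sdprod _ 6); vm_compute. Qed.

Lemma isog_N_C4 : tab_group N_C4_group \isog C2_pow3.
Proof.
apply: isog_C2_pow3; last by rewrite card_tab_group.
by apply: tab_group_abelem2; vm_compute.
Qed.

Lemma C7_rtimes_C3_H_C4 : is_C7_rtimes_C3 (tab_group H_C4_group).
Proof. by apply: (@tab_group_C7_rtimes_C3 aff_C4 dbl_C4); vm_compute. Qed.

Lemma code_aut_C4 : exists N H : {group 'S_15},
  [/\ N ><| H = code_aut 15 des_C4, N \isog C2_pow3 & is_C7_rtimes_C3 H].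
Proof.
exists (tab_group N_C4_group), (tab_group H_C4_group).
by split; [exact: sdprod_C4 | exact: isog_N_C4 | exact: C7_rtimes_C3_H_C4].
Qed.

Lemma N_NC_group : is_tab_group 15 N_NC.
Proof. vm_cast_no_check (erefl true). Qed.

Lemma H_NC_group : is_tab_group 15 H_NC.
Proof. vm_cast_no_check (erefl true). Qed.

Lemma sdprod_NC : tab_group N_NC_group ><| tab_group H_NC_group = code_aut 15 des_NC.
Proof. by apply: (@code_aut_sdprod _ 5); vm_compute. Qed.

Lemma isog_N_NC : tab_group N_NC_group \isog C2_pow3.
Proof.
apply: isog_C2_pow3; last by rewrite card_tab_group.
by apply: tab_group_abelem2; vm_compute.
Qed.

Lemma C7_rtimes_C3_H_NC : is_C7_rtimes_C3 (tab_group H_NC_group).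
Proof. by apply: (@tab_group_C7_rtimes_C3 aff_NC dbl_NC); vm_compute. Qed.

Lemma code_aut_NC : exists N H : {group 'S_15},
  [/\ N ><| H = code_aut 15 des_NC, N \isog C2_pow3 & is_C7_rtimes_C3 H].
Proof.
exists (tab_group N_NC_group), (tab_group H_NC_group).
by split; [exact: sdprod_NC | exact: isog_N_NC | exact: C7_rtimes_C3_H_NC].
Qed.


(** * Codes of a set of blocks, and symmetric differences *)

Definition codes n (s : 'S_n) (B : {set {set 'I_n}}) := [seq code s X | X <- enum B].

Lemma mem_codes n (s : 'S_n) (B : {set {set 'I_n}}) X :
  (code s X \in codes s B) = (X \in B).
Proof. by rewrite mem_map ?mem_enum //; apply: code_inj. Qed.

Section Symdiff.
Variable T : finType.
Implicit Types X Y : {set T}.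

Lemma symdiffC X Y : symdiff X Y = symdiff Y X.
Proof. by rewrite /symdiff setUC. Qed.

Lemma symdiffK X Y : symdiff X (symdiff X Y) = Y.
Proof.
by apply/setP=> i; rewrite !inE; case: (i \in X); case: (i \in Y).
Qed.

Lemma symdiffv X : symdiff X X = set0.
Proof. by rewrite /symdiff setDv setU0. Qed.

Lemma symdiff0 X : symdiff X set0 = X.
Proof. by rewrite /symdiff setD0 set0D setU0. Qed.

Lemma symdiff_eq0 X Y : (symdiff X Y == set0) = (X == Y).
Proof.
apply/eqP/eqP=> [E|->]; last exact: symdiffv.
by rewrite -(symdiffK X Y) E symdiff0.
Qed.

Lemma symdiff_eql X Y : (symdiff X Y == X) = (Y == set0).
Proof.
apply/eqP/eqP=> [E|->]; last exact: symdiff0.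
by rewrite -(symdiffK X Y) E symdiffv.
Qed.

Lemma card_symdiff X Y : (#|symdiff X Y| + 2 * #|X :&: Y|)%N = (#|X| + #|Y|)%N.
Proof.
rewrite /symdiff cardsU -[#|X|](cardsID Y X) -[#|Y|](cardsID X Y) (setIC Y X).
suff -> : (X :\: Y) :&: (Y :\: X) = set0 by rewrite cards0 subn0; lia.
by apply/setP=> i; rewrite !inE; case: (i \in X); case: (i \in Y).
Qed.
End Symdiff.

(** * Three blocks in standard position *)

Section Labelling.
Variables X Y Z : {set 'I_15}.
Hypotheses (cX : #|X| = 8) (cY : #|Y| = 8) (cZ : #|Z| = 8).
Hypotheses (cXY : #|X :&: Y| = 4) (cXZ : #|X :&: Z| = 4) (cYZ : #|Y :&: Z| = 4).

Lemma card_symdiff_meet :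
  (#|symdiff X Y :&: Z| + 2 * #|X :&: Y :&: Z|)%N = (#|X :&: Z| + #|Y :&: Z|)%N.
Proof.
have -> : symdiff X Y :&: Z = symdiff (X :&: Z) (Y :&: Z).
  apply/setP=> i; rewrite !inE.
  by case: (i \in X); case: (i \in Y); case: (i \in Z).
rewrite -card_symdiff; congr (_ + 2 * #|pred_of_set _|)%N; apply/setP=> i.
by rewrite !inE; case: (i \in X); case: (i \in Y); case: (i \in Z).
Qed.

Hypothesis (cXYZ : #|X :&: Y :&: Z| = 2).

Let atom (v : bool * bool * bool) :=
  [set i | (i \in X, i \in Y, i \in Z) == v].

Let atomE v (A : {set 'I_15}) :
  (forall i, ((i \in X, i \in Y, i \in Z) == v) = (i \in A)) -> #|atom v| = #|A|.
Proof. by move=> H; apply: eq_card => i; rewrite inE H. Qed.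

Let card_atom v : #|atom v| = if v == (false, false, false) then 1%N else 2.
Proof.
have h (A C : {set 'I_15}) : (#|A :\: C| = #|A| - #|A :&: C|)%N.
  by rewrite -(cardsID C A) addKn.
have cI (A C D : {set 'I_15}) :
    #|A :&: C :&: D| = 2 -> #|(A :\: C) :&: D| = (#|A :&: D| - 2)%N.
  by move=> E; rewrite setIDAC h setIAC E.
have XZY : #|X :&: Z :&: Y| = 2 by rewrite setIAC.
have YZX : #|Y :&: Z :&: X| = 2 by rewrite setIC setIA.
have YXZ : #|Y :&: X :&: Z| = 2 by rewrite (setIC Y).
have ZXY : #|Z :&: X :&: Y| = 2 by rewrite (setIC Z).
have cYX : #|Y :&: X| = 4 by rewrite setIC.
have cZX : #|Z :&: X| = 4 by rewrite setIC.
have cZY : #|Z :&: Y| = 4 by rewrite setIC.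
have eqs := (h, cI, cX, cY, cZ, cXY, cXZ, cYZ, cYX, cZX, cZY, cXYZ, XZY, YZX,
             YXZ, ZXY).
(* By inclusion-exclusion the union has 24 - 12 + 2 = 14 of the 15 points. *)
have none : #|~: (X :|: Y :|: Z)| = 1%N.
  have /= := cardsC (X :|: Y :|: Z); rewrite card_ord cardsU setIUl !cardsU.
  have -> : X :&: Z :&: (Y :&: Z) = X :&: Y :&: Z.
    by apply/setP=> i; rewrite !inE; do !case: (_ \in _).
  by rewrite ?eqs; lia.
case: v => [[[] []] []] /=;
  [ rewrite (@atomE _ (X :&: Y :&: Z)) | rewrite (@atomE _ (X :&: Y :\: Z))
  | rewrite (@atomE _ (X :&: Z :\: Y)) | rewrite (@atomE _ (X :\: Y :\: Z))
  | rewrite (@atomE _ (Y :&: Z :\: X)) | rewrite (@atomE _ (Y :\: X :\: Z))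
  | rewrite (@atomE _ (Z :\: X :\: Y)) | rewrite (@atomE _ (~: (X :|: Y :|: Z))) ];
  rewrite ?eqs // => i; rewrite !inE !xpair_eqE; by do !case: (_ \in _).
Qed.

(** Each nonzero membership pattern occurs for two points and the zero pattern for one, exactly as
    for the first three coordinates of the nonzero vectors of F_2^4. Matching equal patterns gives
    the labelling. *)
Lemma standard_labelling : exists s : 'S_15,
  [/\ code s X = cA, code s Y = cB & code s Z = cC].
Proof.
pose pat (i : 'I_15) := (i \in X, i \in Y, i \in Z).
pose std := [seq (bit i cA, bit i cB, bit i cC) | i <- iota 0 15].
have pstd : perm_eq std (map pat (enum 'I_15)).
  apply/allP=> v _ /=; apply/eqP; rewrite [RHS]count_map.
  rewrite -[RHS]/(count (fun i => pat i == v) _).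
  have -> : count (fun i => pat i == v) (enum 'I_15) = #|atom v|.
    rewrite -(count_perm 1); apply: eq_count => i; by rewrite perm1 inE.
  by rewrite card_atom; case: v => [[[] []] []].
have [Is pI E] := perm_iotaP (false, false, false) pstd.
rewrite size_map size_enum_ord in pI.
have [s Es] := is_tabP pI; exists s.
have bits i : nth (false, false, false) std (val i) = pat (s i).
  rewrite E -Es (nth_map 0) ?size_tab //= nth_tab.
  by rewrite (nth_map (s i)) ?size_enum_ord // nth_ord_enum.
have H (W : {set 'I_15}) (c : bitseq) (f : bool * bool * bool -> bool) :
    size c = 15 -> (forall i, f (pat i) = (i \in W)) ->
    c = map f std -> code s W = c.
  move=> sc fp Ec; apply: (@eq_from_nth _ false); rewrite size_code // => i li.
  rewrite -/(bit i _) (bit_code s W (Ordinal li)) -fp -bits.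
  by rewrite Ec (nth_map (false, false, false)).
by split; [apply: (H _ _ (fun v => v.1.1))|apply: (H _ _ (fun v => v.1.2))
          |apply: (H _ _ (fun v => v.2))].
Qed.
End Labelling.

Lemma card_set3 (T : finType) (x y z : T) : #|[set x; y; z]| <= 3.
Proof.
apply: leq_trans (leq_card_setU _ _) _; rewrite cards2 cards1.
by case: (x != y).
Qed.

Lemma mem_bitseqs n x : size x = n -> x \in bitseqs n.
Proof.
elim: n x => [|n IH] [|b x] //= [sx].
by rewrite mem_cat; case: b; rewrite map_f ?orbT ?IH.
Qed.

Lemma mem_candidates known x : size x = 15 -> weight x = 8 ->
  {in known, forall y, meet x y = 4} -> x \in candidates known.
Proof.
move=> sx wx mx; rewrite /candidates mem_filter mem_bitseqs // wx andbT.
by apply/allP=> y /mx->.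
Qed.

Lemma isomorphicP l0 l : isomorphic l0 l ->
  exists2 t, is_tab 15 t & perm_eq l0 (map (relabel t) l).
Proof.
by rewrite /isomorphic; move: (first_extension _ _ _ _ _) => t /andP[]; exists t.
Qed.

(** * Lines and Fano planes inside a design *)

Section Design.
Variable B : {set {set 'I_15}}.
Hypothesis hB : symmetric_design 4 B.
Implicit Types (X Y : {set 'I_15}) (S M : {set {set 'I_15}}).

Let card_B X : X \in B -> #|X| = 8. Proof. by case: hB => _ + _ => /[apply]. Qed.

Let card_BI X Y : X \in B -> Y \in B -> X != Y -> #|X :&: Y| = 4.
Proof. by case: hB => _ _; apply. Qed.

Let set0B : set0 \notin B.
Proof. by apply/negP=> /card_B; rewrite cards0. Qed.

Lemma is_line_symdiff X Y : X \in B -> Y \in B -> X != Y ->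
  is_line [set X; Y; symdiff X Y].
Proof.
move=> XB YB XY; apply/existsP; exists X; apply/existsP; exists Y.
rewrite /is_point (card_B XB) (card_B YB) !eqxx /= andbT; apply/eqP.
have := card_symdiff X Y; rewrite (card_BI XB YB XY) (card_B XB) (card_B YB).
exact: (@addIn (2 * 4)%N _ 8).
Qed.

Lemma line_symdiff M X Y :
  is_line M -> X \in M -> Y \in M -> X != Y -> symdiff X Y \in M.
Proof.
case/existsP=> U /existsP[V /and4P[_ _ _ /eqP->]]; rewrite !inE.
case/orP=> [/orP[]|] /eqP-> /orP[/orP[]|] /eqP->; rewrite ?eqxx // => _.
- by rewrite orbT.
- by rewrite symdiffK eqxx orbT.
- by rewrite symdiffC eqxx !orbT.
- by rewrite (symdiffC U) symdiffK eqxx.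
- by rewrite symdiffC symdiffK eqxx orbT.
- by rewrite (symdiffC U) symdiffC symdiffK eqxx.
Qed.

Lemma singular_symdiff S X Y : singular S -> S \subset B ->
  X \in S -> Y \in S -> X != Y -> symdiff X Y \in S.
Proof.
case/andP=> _ /forall_inP sS /subsetP SB XS YS XY.
have /forall_inP/(_ Y YS) := sS X XS.
rewrite XY => /andP[_ /forallP/(_ [set X; Y; symdiff X Y])].
rewrite is_line_symdiff ?SB // !inE !eqxx orbT /= => /subsetP; apply.
by rewrite !inE eqxx orbT.
Qed.

(** The search finds the codes of [B] up to order, and [cond] holds for them, so some table carries
    them to [l0]; composing it with [s] gives the new labelling. *)
Lemma classify s ext known (cond : pred (seq bitseq)) l0 :
  uniq known -> {subset known <= codes s B} ->
  {in codes s B, forall x, x \in ext x /\ {subset ext x <= codes s B}} ->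
  (forall l, l =i codes s B -> cond l) ->
  classified ext known cond l0 ->
  exists s' : 'S_15, forall X, (X \in B) = (code s' X \in l0).
Proof.
move=> uk kB extB condB /allP cl.
have uB : uniq (codes s B) by rewrite map_inj_uniq ?enum_uniq //; apply: code_inj.
have sB : size (codes s B) = 15 by rewrite size_map -cardE; case: hB.
have mB : {in codes s B &, forall x y, x != y -> meet x y = 4}.
  move=> _ _ /mapP[X XB ->] /mapP[Y YB ->]; rewrite meet_code !mem_enum in XB YB *.
  by move=> XY; apply: card_BI => //; apply: contraNneq XY => ->.
have kc : {subset codes s B <= known ++ candidates known}.
  move=> x xB; rewrite mem_cat; case xk: (x \in known) => //=.
  have [X XB Ex] := mapP xB; rewrite mem_enum in XB.
  apply: mem_candidates => [||y yk]; first by rewrite Ex size_code.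
    by rewrite Ex weight_code card_B.
  by apply: (mB _ _ xB (kB _ yk)); apply/eqP=> E; rewrite E yk in xk.
have [l ls lB] := search_complete sB uB mB extB (leqnn _) uk kB kc.
have := cl _ ls; rewrite condB; last exact: perm_mem.
case/isomorphicP => t vt pt.
have [w Ew] := is_tabP vt; exists (w * s) => X.
rewrite code_mul Ew (perm_mem pt) -(mem_codes s) -(perm_mem lB).
apply/idP/mapP=> [Xl | [y yl]]; first by exists (code s X).
move: (yl); rewrite (perm_mem lB) => /mapP[Y _ E].
by rewrite E -Ew -!code_mul => /code_inj->; rewrite -E.
Qed.

(** Supplies the closure hypothesis of [classify]: the empty set in [R] gives [X] itself, and the
    sums that survive the filter are blocks. *)
Lemma translates_codes s (R : seq {set 'I_15}) X :
  set0 \in R -> X \in B ->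
  {in R, forall Z, Z != X -> symdiff Z X \in B} ->
  code s X \in translates (map (code s) R) (code s X) /\
  {subset translates (map (code s) R) (code s X) <= codes s B}.
Proof.
move=> R0 XB RB; have hasE Y : has id (code s Y) = (Y != set0).
  by rewrite has_count -/(weight _) weight_code card_gt0.
split=> [|y]; rewrite mem_filter.
  rewrite hasE; apply/andP; split; first by apply: contraTneq XB => ->.
  apply/mapP; exists (code s set0); first exact: map_f.
  by rewrite -code_symdiff symdiffC symdiff0.
case/andP=> + /mapP[_ /mapP[Z ZR ->] E]; rewrite {}E -code_symdiff hasE => ne.
by rewrite mem_codes RB //; rewrite symdiff_eq0 in ne.
Qed.

Lemma code_zero (s : 'S_15) : code s set0 = zero.
Proof.
apply: (@eq_from_nth _ false); rewrite size_code // => i li.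
rewrite -/(bit i _) (bit_code s _ (Ordinal li)) inE.
by rewrite -[zero]/(nseq 15 false) nth_nseq if_same.
Qed.

Section Labelling.
Variables a b c : {set 'I_15}.
Hypotheses (aB : a \in B) (bB : b \in B) (cinB : c \in B).
Hypotheses (ab : a != b) (ac : a != c) (bc : b != c).
Hypotheses (abB : symdiff a b \in B) (abc : symdiff a b != c).

(** As the sum of [a] and [b] is a block other than [c], it meets [c] in 4 points, which forces the
    triple intersection to have 4 + 4 - 4 = 2 * 2 over 2, that is 2, points. *)
Lemma design_labelling : exists s : 'S_15,
  [/\ code s a = cA, code s b = cB & code s c = cC].
Proof.
apply: (standard_labelling (card_B aB) (card_B bB) (card_B cinB)
         (card_BI aB bB ab) (card_BI aB cinB ac) (card_BI bB cinB bc)).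
have := card_symdiff_meet a b c.
rewrite (card_BI abB cinB abc) (card_BI aB cinB ac) (card_BI bB cinB bc) => E.
by apply: double_inj; rewrite -mul2n; apply: (@addnI 4 _ 4); rewrite E.
Qed.
End Labelling.

Section Fano.
Variable F : {set {set 'I_15}}.
Hypotheses (fF : fano_plane F) (FB : F \subset B).

Lemma card_fano : #|F| = 7.
Proof.
case: fF => _ [f [injf <- _]].
by rewrite card_in_imset // cardsC1 card_mx card_Fp.
Qed.

Lemma fano_symdiff X Y : X \in F -> Y \in F -> X != Y -> symdiff X Y \in F.
Proof. by apply: singular_symdiff => //; case: fF. Qed.

(** A point [c] off the line through [a] and [b] completes them to a basis of the plane. The seven
    sums have the standard codes and, by counting, exhaust [F]. *)
Lemma fano_labelling a b : a \in F -> b \in F -> a != b ->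
  exists s : 'S_15, [/\ code s a = cA, code s b = cB
    & forall X, (code s X \in std_fano) = (X \in F)].
Proof.
move=> aF bF ab; have /subsetP FsB := FB.
have abF := fano_symdiff aF bF ab.
have [c cF] : exists2 c, c \in F & c \notin [set a; b; symdiff a b].
  apply/subsetPn; apply/negP=> /subset_leq_card; rewrite card_fano => le7.
  by have := leq_trans le7 (card_set3 _ _ _).
rewrite !inE !negb_or => /andP[/andP[ca cb] cab].
have [s [Ea Eb Ec]] : exists s : 'S_15,
    [/\ code s a = cA, code s b = cB & code s c = cC].
  by apply: design_labelling; rewrite ?FsB // eq_sym.
have sub : {subset std_fano <= codes s F}.
  have acF : symdiff a c \in F by rewrite fano_symdiff // eq_sym.
  have bcF : symdiff b c \in F by rewrite fano_symdiff // eq_sym.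
  have abcF : symdiff (symdiff a b) c \in F by rewrite fano_symdiff // eq_sym.
  have -> : std_fano = map (code s) [:: a; b; symdiff a b; c; symdiff a c;
                              symdiff b c; symdiff (symdiff a b) c].
    by rewrite /= !code_symdiff Ea Eb Ec.
  apply/allP; rewrite all_map; apply/allP=> X /=; rewrite mem_codes !inE.
  by do 6![case/predU1P=> [->//|]] => /eqP->.
exists s; split=> // X; rewrite -(mem_codes s).
apply: (uniq_min_size _ sub _).2 => //.
by rewrite size_map -cardE card_fano.
Qed.
End Fano.
End Design.

(** * Reduction of each type to its explicit design *)

Lemma classified_C2 : classified ext_line std_fano cond_C2 des_C2.
Proof. vm_cast_no_check (erefl true). Qed.

Lemma classified_C3 : classified ext_point std_fano cond_C3 des_C3.
Proof. vm_cast_no_check (erefl true). Qed.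

Lemma classified_C4 : classified ext_point std_lines cond_C4 des_C4.
Proof. vm_cast_no_check (erefl true). Qed.

Lemma classified_NC : classified ext_self std_fano cond_NC des_NC.
Proof. vm_cast_no_check (erefl true). Qed.

Section Types.
Variable B : {set {set 'I_15}}.
Hypothesis hB : symmetric_design 4 B.
Implicit Types (X Y : {set 'I_15}) (F M : {set {set 'I_15}}).

Let set0B : set0 \notin B.
Proof. by apply/negP=> X0; case: hB => _ /(_ _ X0); rewrite cards0. Qed.

Let isB X Y : symdiff X Y \in B -> X != Y.
Proof. by move=> XY; apply: contraNneq set0B => E; rewrite E symdiffv in XY. Qed.

Let line_in_design M : is_line M -> forall X Y, X \in M -> Y \in M -> X != Y ->
  M \subset B -> symdiff X Y \in B.
Proof. by move=> lM X Y XM YM XY /subsetP; apply; apply: line_symdiff lM _ _ _. Qed.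

Let known_fano s F : F \subset B ->
    (forall X, (code s X \in std_fano) = (X \in F)) ->
  {subset std_fano <= codes s B}.
Proof.
move=> /subsetP FB sF x xF; have sx : size x = 15.
  by apply/eqP; move: x xF; apply/allP; vm_compute.
by have [X E] := code_surj s sx; rewrite -E mem_codes FB // -sF E.
Qed.

Let closed_ext_point s p : p \in B -> code s p = cA ->
    (forall X, X \in B -> p != X -> symdiff p X \in B) ->
  {in codes s B, forall x, x \in ext_point x /\ {subset ext_point x <= codes s B}}.
Proof.
move=> pB Ep cl _ /mapP[X + ->]; rewrite mem_enum => XB.
have -> : ext_point = translates (map (code s) [:: set0; p]).
  by rewrite /= code_zero Ep.
apply: translates_codes; rewrite ?mem_head // => Z; rewrite !inE => /orP[]/eqP->.
  by rewrite symdiffC symdiff0.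
exact: cl.
Qed.

(** The common line provides closure under [ext_line]. For [cond_C2], closure of [B] under all sums
    of distinct blocks would make [F1] the union of its intersections with [F2] and [F3], but a
    projective plane is not the union of two proper subspaces. *)
Lemma type_C2_canonical : type_C2 B ->
  exists s : 'S_15, forall X, (X \in B) = (code s X \in des_C2).
Proof.
case=> F1 [F2 [F3 [L [[f1 f2 f3] [n12 n13 n23] [lL [L1 L2 L3]] defB lines]]]].
have B1 : F1 \subset B by rewrite defB -setUA subsetUl.
have B2 : F2 \subset B by rewrite defB setUAC subsetUr.
have B3 : F3 \subset B by rewrite defB subsetUr.
have inB X : X \in B -> [|| X \in F1, X \in F2 | X \in F3].
  by rewrite defB !inE orbA.
case/existsP: (lL) => a /existsP[b /and4P[/eqP ca /eqP cb /eqP cab /eqP defL]].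
have aL : a \in L by rewrite defL !inE eqxx.
have bL : b \in L by rewrite defL !inE eqxx orbT.
have ab : a != b by apply/eqP=> E; move: cab; rewrite E symdiffv cards0.
have clL Z X : Z \in L -> X \in B -> Z != X -> symdiff Z X \in B.
  move=> ZL /inB/or3P[] XF ZX.
  - by apply: (subsetP B1); apply: (fano_symdiff hB f1) => //; apply: (subsetP L1).
  - by apply: (subsetP B2); apply: (fano_symdiff hB f2) => //; apply: (subsetP L2).
  - by apply: (subsetP B3); apply: (fano_symdiff hB f3) => //; apply: (subsetP L3).
have abL : symdiff a b \in L by apply: line_symdiff lL _ _ _.
have [s [Ea Eb sF]] := fano_labelling hB f1 B1 (subsetP L1 _ aL) (subsetP L1 _ bL) ab.
apply: (classify hB (s := s) _ _ _ _ classified_C2) => //.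
- exact: known_fano sF.
- move=> _ /mapP[X + ->]; rewrite mem_enum => XB.
  have -> : ext_line = translates (map (code s) [:: set0; a; b; symdiff a b]).
    by rewrite /= code_zero code_symdiff Ea Eb.
  apply: translates_codes; rewrite ?mem_head // => Z; rewrite !inE.
  case/or4P=> /eqP->; try by apply: clL.
  by rewrite symdiffC symdiff0.
move=> l lB; apply/negbNE/negP=> ncl.
have cl X Y : X \in B -> Y \in B -> X != Y -> symdiff X Y \in B.
  move=> XB YB XY; rewrite -(mem_codes s) -lB code_symdiff.
  apply: contraNT ncl => ncl; apply/hasP; exists (code s X).
    by rewrite lB mem_codes.
  apply/hasP; exists (code s Y); first by rewrite lB mem_codes.
  by rewrite (inj_eq (@code_inj _ s)) XY.
(* The line joining a point of [F] outside [F'] to a point of [F'] outside [F] lies in neither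
   plane, hence in the third. *)
have sub F F' F'' : fano_plane F -> fano_plane F' -> F \subset B -> F' \subset B ->
    (forall M, is_line M -> M \subset B ->
       [|| M \subset F, M \subset F' | M \subset F'']) ->
    F != F' -> forall X, X \in F -> X \notin F' -> X \in F''.
  move=> fF fF' FB FB' lns nFF X XF XF'.
  have [Y YF' YF] : exists2 Y, Y \in F' & Y \notin F.
    apply/subsetPn; apply: contra nFF => sub; rewrite eq_sym eqEcard sub.
    by rewrite (card_fano fF) (card_fano fF').
  have XY : X != Y by apply: contraNneq YF => <-.
  have XB := subsetP FB _ XF; have YB := subsetP FB' _ YF'.
  have lXY := is_line_symdiff hB XB YB XY.
  have : [set X; Y; symdiff X Y] \subset B.
    apply/subsetP=> Z; rewrite !inE => /orP[/orP[]|]/eqP-> //; exact: cl.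
  case/(lns _ lXY)/or3P => /subsetP sM.
  - by rewrite sM // !inE eqxx orbT in YF.
  - by rewrite sM // !inE eqxx in XF'.
  - by rewrite sM // !inE eqxx.
have s12 : forall X, X \in F1 -> X \notin F2 -> X \in F3.
  by apply: sub n12 => // M lM; rewrite lines.
have s13 : forall X, X \in F1 -> X \notin F3 -> X \in F2.
  apply: sub n13 => // M lM; rewrite lines // => /or3P[]->; rewrite ?orbT //.
have [X X1 X2] : exists2 X, X \in F1 & X \notin F2.
  apply/subsetPn; apply: contra n12 => sub12; rewrite eqEcard sub12.
  by rewrite (card_fano f1) (card_fano f2).
have [Y Y1 Y3] : exists2 Y, Y \in F1 & Y \notin F3.
  apply/subsetPn; apply: contra n13 => sub13; rewrite eqEcard sub13.
  by rewrite (card_fano f1) (card_fano f3).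
have X3 := s12 _ X1 X2; have Y2 := s13 _ Y1 Y3.
have XY : X != Y by apply: contraNneq X2 => ->.
have XYB : symdiff X Y \in F1 by apply: (fano_symdiff hB f1).
have := fano_symdiff hB f2 B2 Y2; have := fano_symdiff hB f3 B3 X3.
(* The sum of [X] and [Y] lies in [F2] or [F3]; adding [Y] in the first case puts [X] into [F2],
   adding [X] in the second puts [Y] into [F3]. *)
have [XY2 _ /(_ _ XY2) | XY2 /(_ _ (s12 _ XYB XY2)) + _] := boolP (symdiff X Y \in F2).
  rewrite (symdiffC X) symdiffK (negbTE X2) => H; apply/notF/H.
  rewrite eq_sym symdiff_eql; apply: contraNneq set0B => <-.
  exact: (subsetP B1).
rewrite symdiffK (negbTE Y3) => H; apply/notF/H.
rewrite eq_sym symdiff_eql; apply: contraNneq set0B => <-.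
exact: (subsetP B1).
Qed.

(** All blocks lie on lines of [B] through [p]. A line of [B] through a point outside [F] passes
    through [p]; if it also contained another point of [F], it would lie in [F]. *)
Lemma type_C3_canonical : type_C3 B ->
  exists s : 'S_15, forall X, (X \in B) = (code s X \in des_C3).
Proof.
case=> F [p [Ls [[fF pF] _ pLs defB lines]]].
have FB : F \subset B by rewrite defB subsetUl.
have [b bF bp] : exists2 b, b \in F & b \notin [set p].
  apply/subsetPn; apply/negP=> /subset_leq_card.
  by rewrite (card_fano fF) cards1.
rewrite inE eq_sym in bp.
have [s [Ep _ sF]] := fano_labelling hB fF FB pF bF bp.
have pB := subsetP FB _ pF.
apply: (classify hB (s := s) _ _ _ _ classified_C3) => //.
- exact: known_fano sF.
- apply: closed_ext_point Ep _ => // X.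
  rewrite {1}defB inE => /orP[XF|/bigcupP[M MLs XM]] pX.
    by apply: (subsetP FB); apply: (fano_symdiff hB fF).
  have [lM pM] := pLs M MLs.
  by apply: (line_in_design lM); rewrite // lines // MLs orbT.
move=> l lB; apply/allP=> x; rewrite mem_filter lB => /andP[xF /mapP[X + E]].
rewrite mem_enum {x}E sF in xF * => XB.
apply/allP=> y; rewrite mem_filter => /andP[yA yF].
have sy : size y = 15 by apply/eqP; move: y yF {yA}; apply/allP; vm_compute.
have [Y EY] := code_surj s sy.
rewrite -{y sy}EY sF -Ep (inj_eq (@code_inj _ s)) in yA yF *.
rewrite lB -code_symdiff mem_codes; apply/negP=> XYB.
have YB := subsetP FB _ yF; have XY := isB XYB.
have lM := is_line_symdiff hB XB YB XY.
have : [set X; Y; symdiff X Y] \subset B.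
  by apply/subsetP=> Z; rewrite !inE => /orP[/orP[]|]/eqP->.
rewrite lines // => /orP[/subsetP sub | /pLs[_]].
  by rewrite sub // !inE eqxx in xF.
rewrite !inE => /orP[/orP[]|]/eqP E.
- by rewrite -E pF in xF.
- by rewrite E eqxx in yA.
case/negP: xF; have -> : X = symdiff Y p by rewrite E (symdiffC X) symdiffK.
exact: (fano_symdiff hB fF).
Qed.

(** Two of the lines through [p] take the place of a Fano plane: their points [p], [X], [Y] admit a
    standard labelling. Every line of [B] contains [p], which is [cond_C4]. *)
Lemma type_C4_canonical : type_C4 B ->
  exists s : 'S_15, forall X, (X \in B) = (code s X \in des_C4).
Proof.
case=> p [Ls [cLs pLs defB lines]].
have cl X : X \in B -> p != X -> symdiff p X \in B.
  rewrite {1}defB => /bigcupP[M MLs XM] pX; have [lM pM] := pLs M MLs.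
  by apply: (line_in_design lM); rewrite // lines.
have pB : p \in B.
  have [M MLs] : exists M, M \in Ls by apply/set0Pn; rewrite -card_gt0 cLs.
  by rewrite defB; apply/bigcupP; exists M => //; case: (pLs M MLs).
have cB' : #|B| = 15 by case: hB.
have [X XB pX] : exists2 X, X \in B & X \notin [set p].
  by apply/subsetPn; apply/negP=> /subset_leq_card; rewrite cB' cards1.
rewrite inE eq_sym in pX; have pXB := cl _ XB pX.
have [Y YB] : exists2 Y, Y \in B & Y \notin [set p; X; symdiff p X].
  apply/subsetPn; apply/negP=> /subset_leq_card; rewrite cB' => le15.
  by have := leq_trans le15 (card_set3 _ _ _).
rewrite !inE !negb_or => /andP[/andP[Yp YX] YpX].
have [s [Ep EX EY]] : exists s : 'S_15,
    [/\ code s p = cA, code s X = cB & code s Y = cC].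
  by apply: (design_labelling hB) => //; rewrite eq_sym.
apply: (classify hB (s := s) _ _ _ _ classified_C4) => //.
- have -> : std_lines = map (code s) [:: p; X; symdiff p X; Y; symdiff p Y].
    by rewrite /= !code_symdiff Ep EX EY.
  apply/allP; rewrite all_map; apply/allP=> Z /=; rewrite mem_codes !inE.
  do 4![case/predU1P=> [->//|]] => /eqP->; apply: cl => //.
  by rewrite eq_sym.
- exact: closed_ext_point cl.
move=> l lB; apply/allP=> x; rewrite mem_filter lB => /andP[xA /mapP[U + E]].
rewrite mem_enum {x}E -Ep (inj_eq (@code_inj _ s)) in xA * => UB.
apply/allP=> y; rewrite mem_filter lB => /andP[yA /mapP[V + E]].
rewrite mem_enum {y}E (inj_eq (@code_inj _ s)) in yA * => VB.
rewrite lB -code_symdiff mem_codes (inj_eq (@code_inj _ s)).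
case UVB : (symdiff U V \in B); rewrite ?orbT // orbF.
have lM := is_line_symdiff hB UB VB (isB UVB).
have : [set U; V; symdiff U V] \subset B.
  by apply/subsetP=> Z; rewrite !inE => /orP[/orP[]|]/eqP->.
rewrite lines // => /pLs[_]; rewrite !inE !(eq_sym p).
by rewrite (negbTE xA) (negbTE yA).
Qed.

(** The plane [G] is put in standard position; since all lines of [B] lie in [G], a block outside
    [G] is on no line of [B], which gives [cond_NC]. *)
Lemma type_NC_canonical : type_NC B ->
  exists s : 'S_15, forall X, (X \in B) = (code s X \in des_NC).
Proof.
case=> S [F [G [_ _ [fG _] defB lines]]].
have GB : G \subset B by rewrite defB subsetUr.
have [a aG] : exists a, a \in G by apply/set0Pn; rewrite -card_gt0 (card_fano fG).
have [b bG ba] : exists2 b, b \in G & b \notin [set a].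
  apply/subsetPn; apply/negP=> /subset_leq_card.
  by rewrite (card_fano fG) cards1.
rewrite inE eq_sym in ba.
have [s [_ _ sG]] := fano_labelling hB fG GB aG bG ba.
apply: (classify hB (s := s) _ _ _ _ classified_NC) => //.
- exact: known_fano sG.
- by move=> x xB; rewrite inE eqxx; split=> // y; rewrite inE => /eqP->.
move=> l lB; apply/allP=> x; rewrite mem_filter lB => /andP[xG /mapP[X + E]].
rewrite mem_enum {x}E sG in xG * => XB.
apply/allP=> y; rewrite lB => /mapP[Y + ->]; rewrite mem_enum => YB.
rewrite lB -code_symdiff mem_codes; apply: contra xG => XYB.
have lM := is_line_symdiff hB XB YB (isB XYB).
have : [set X; Y; symdiff X Y] \subset B.
  by apply/subsetP=> Z; rewrite !inE => /orP[/orP[]|]/eqP->.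
by rewrite lines // => /subsetP->; rewrite // !inE eqxx.
Qed.
End Types.

(** * Transport from the explicit designs to arbitrary ones *)

Lemma sdprod_transport (B : {set {set 'I_15}}) (s : 'S_15) l (N H : {group 'S_15}) :
  uniq l && all (fun b => size b == 15) l ->
  (forall X, (X \in B) = (code s X \in l)) ->
  N ><| H = code_aut 15 l -> (N :^ s)%G ><| (H :^ s)%G = design_aut B.
Proof.
case/andP=> ul sl Bl defA.
by rewrite /= -sdprodJ defA -(design_aut_code ul sl Bl).
Qed.

Theorem theorem2 (B : {set {set 'I_15}}) (hB : symmetric_design 4 B) :
  [/\ type_C2 B ->
        exists N H : {group {perm 'I_15}},
          [/\ N ><| H = design_aut B,
              is_semidirect N C2_pow2 'Sym_('I_4)
            & H \isog 'Sym_('I_3)],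
      type_C3 B ->
        exists N H : {group {perm 'I_15}},
          [/\ N ><| H = design_aut B, N \isog C2_pow3 & H \isog 'Alt_('I_4)]
    & type_C4 B \/ type_NC B ->
        exists N H : {group {perm 'I_15}},
          [/\ N ><| H = design_aut B, N \isog C2_pow3 & is_C7_rtimes_C3 H]].
Proof.
split.
- case/(type_C2_canonical hB) => s Bl; have [N [H [defA sN iH]]] := code_aut_C2.
  exists (N :^ s)%G, (H :^ s)%G; split; first exact: sdprod_transport Bl defA.
    exact: (@is_semidirectJ _ _ _ N [group of C2_pow2]).
  exact: isogJ.
- case/(type_C3_canonical hB) => s Bl; have [N [H [defA iN iH]]] := code_aut_C3.
  exists (N :^ s)%G, (H :^ s)%G; split; first exact: sdprod_transport Bl defA.
    exact: (isogJ (A := [group of C2_pow3])).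
  exact: isogJ.
(* Types (C4) and (NC) share this transport, as their explicit groups have the same form. *)
have main l s : uniq l && all (fun b => size b == 15) l ->
    (forall X, (X \in B) = (code s X \in l)) ->
    (exists N H : {group 'S_15},
      [/\ N ><| H = code_aut 15 l, N \isog C2_pow3 & is_C7_rtimes_C3 H]) ->
    exists N H : {group {perm 'I_15}},
      [/\ N ><| H = design_aut B, N \isog C2_pow3 & is_C7_rtimes_C3 H].
  move=> vl Bl [N [H [defA iN [sH nH]]]].
  exists (N :^ s)%G, (H :^ s)%G; split; first exact: sdprod_transport Bl defA.
    exact: (isogJ (A := [group of C2_pow3])).
  split; last by rewrite abelianJ.
  exact: (@is_semidirectJ _ _ _ H [group of Zp 7] [group of Zp 3]).
case=> [/(type_C4_canonical hB)|/(type_NC_canonical hB)] [s Bl].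
  by apply: (main _ s _ Bl code_aut_C4).
by apply: (main _ s _ Bl code_aut_NC).
Qed.
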